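(* Let $1\le r\le d$ and let $\mathcal{X}$ be a set. Suppose given an $n$-tuple operation $\Phi:\mathcal{X}^n\to\mathcal{X}$ and a function $\Gamma:\mathbb{R}^n\to\mathbb{R}$ that is nondecreasing in each variable, together with (1) for each $I\subset[d]$ with $|I|=r$, a map $\Lambda_I:\mathcal{X}\to\mathbb{R}$; (2) for each $L\in\mathrm{Gr}(r,d)$, a map $\Theta_L:\mathcal{X}\to\mathbb{R}$; (3) for each $X\in\mathcal{X}$, two complete flags $F_\bullet^-(X)$ and $F_\bullet^+(X)$ in $\mathbb{C}^d$. Assume: (L1) for all $X\in\mathcal X$ and all such $I$: if $L\in\Omega_{I^\vee}(F_\bullet^-(X))$ then $\Lambda_I(X)\le\Theta_L(X)$; and if $L\in\Omega_I(F_\bullet^+(X))$ then $\Theta_L(X)\le\Lambda_I(X)$; (L2) $\Theta_L(\Phi(X_1,\dots,X_n))\ge\Gamma(\Theta_L(X_1),\dots,\Theta_L(X_n))$ for all $L\in\mathrm{Gr}(r,d)$ and all $X_1,\dots,X_n\in\mathcal{X}$. Then for every Horn tuple $(I_1,\dots,I_n;K)$ of rank $r$ in dimension $d$ and all $X_1,\dots,X_n\in\mathcal X$, $$\Lambda_K(\Phi(X_1,\dots,X_n))\ge\Gamma(\Lambda_{I_1}(X_1),\dots,\Lambda_{I_n}(X_n)).$$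
   Context: $[d]=\{1,\dots,d\}$; $\mathrm{Gr}(r,d)$ is the set of $r$-dimensional subspaces of $\mathbb{C}^d$. For $I=\{i_1<\dots<i_r\}\subset[d]$, $I^\vee=\{d+1-i_r<\dots<d+1-i_1\}$. For a complete flag $E_\bullet=(E_1\subset\cdots\subset E_d=\mathbb{C}^d)$, $$\Omega_I(E_\bullet)=\{L\in\mathrm{Gr}(r,d):\dim(L\cap E_{i_q})\ge q\text{ for }q=1,\dots,r\}.$$ An $(n+1)$-tuple $(I_1,\dots,I_n;K)$ of $r$-subsets of $[d]$ is a Horn tuple of rank $r$ in dimension $d$ if $$\Omega_{I_1^\vee}(E_\bullet^{(1)})\cap\cdots\cap\Omega_{I_n^\vee}(E_\bullet^{(n)})\cap\Omega_K(G_\bullet)\ne\varnothing$$ for every choice of complete flags $E_\bullet^{(1)},\dots,E_\bullet^{(n)},G_\bullet$ in $\mathbb{C}^d$. *)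

(* Defs.v *)
From mathcomp Require Import all_boot all_order all_algebra.
From mathcomp Require Import classical_sets reals.
From mathcomp Require Import complex.

Set Implicit Arguments.
Unset Strict Implicit.
Unset Printing Implicit Defensive.

Import Order.TTheory GRing.Theory Num.Theory.
Local Open Scope ring_scope.
Local Open Scope classical_set_scope.

(* The index set [d] = {1, ..., d} is represented by 'I_d, so that i : 'I_d
   stands for the integer i + 1. *)

Definition rsubset (r d : nat) := {I : {set 'I_d} | #|I| == r}.

Lemma card_rev_ord (r d : nat) (I : rsubset r d) :
  #|[set rev_ord i | i in val I]%SET| == r.
Proof. by rewrite card_imset ?(valP I) //; apply: rev_ord_inj. Qed.

(* In terms of i + 1, rev_ord is the map i |-> d + 1 - i. *)
Definition dual (r d : nat) (I : rsubset r d) : rsubset r d :=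
  Sub [set rev_ord i | i in val I]%SET (card_rev_ord I).

Definition Csubspace (R : realType) (d : nat) := {vspace 'rV[R[i]]_d}.

Definition Gr (R : realType) (r d : nat) := {L : Csubspace R d | \dim L == r}.

(* The subspace E i has dimension i + 1; in particular the last one is the
   whole space. *)
Record complete_flag (R : realType) (d : nat) := CompleteFlag {
  flag_space :> 'I_d -> Csubspace R d;
  flag_dim : forall i : 'I_d, \dim (flag_space i) = i.+1;
  flag_sub : forall i j : 'I_d, (i <= j)%N ->
    (flag_space i <= flag_space j)%VS }.

(* enum lists ordinals in increasing order, so enum_val q is the (q + 1)-st
   smallest element of I. *)
Definition Omega (R : realType) (r d : nat) (I : rsubset r d)
    (E : complete_flag R d) : set (Gr R r d) :=
  [set L | forall q : 'I_#|val I|,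
     (q.+1 <= \dim (val L :&: E (enum_val q)))%N].

Definition horn_tuple (R : realType) (n r d : nat)
    (I : 'I_n -> rsubset r d) (K : rsubset r d) : Prop :=
  forall (E : 'I_n -> complete_flag R d) (G : complete_flag R d),
    (\bigcap_(k in [set: 'I_n]) Omega (dual (I k)) (E k)) `&` Omega K G !=set0.

Definition nondecreasing_in_each_variable (R : realType) (n : nat)
    (Gamma : ('I_n -> R) -> R) : Prop :=
  forall (k : 'I_n) (x y : 'I_n -> R),
    (forall j, j != k -> x j = y j) -> x k <= y k -> Gamma x <= Gamma y.

(* Main.v *)
Require Import Defs.
From mathcomp Require Import all_boot all_order all_algebra.
From mathcomp Require Import boolp classical_sets reals.
From mathcomp Require Import complex.

Import Order.TTheory GRing.Theory Num.Theory.
Local Open Scope ring_scope.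
Local Open Scope classical_set_scope.

(** The Horn property, applied to the flags [Fminus (x k)] and [Fplus (Phi x)], yields one subspace
    [L] at which [Theta L] dominates every [Lambda (I k) (x k)] and is at most [Lambda K] at
    [Phi x]. Monotonicity of [Gamma] and [L2] at this [L] link the two bounds. *)

(* Only one coordinate may change at a time, so go from x to y through hybrid points. *)
Lemma nondecreasing_in_each_variable_le (R : realType) (n : nat)
    (Gamma : ('I_n -> R) -> R) (x y : 'I_n -> R) :
  nondecreasing_in_each_variable Gamma ->
  (forall k, x k <= y k) -> Gamma x <= Gamma y.
Proof.
move=> mono le_xy.
pose z m (j : 'I_n) := if (j < m)%N then y j else x j.
have -> : y = z n by apply: funext => j; rewrite /z ltn_ord.
have: (n <= n)%N by [].
(* Induction on the number [m] of coordinates already switched to [y]; keeping [m <= n] makes the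
   next one to switch an element of ['I_n]. The point [z 0] is [x] by computation. *)
elim: {1 3}n => [|m IHm] lt_mn; first exact: lexx.
apply: le_trans (IHm (ltnW lt_mn)) _.
apply: (mono (Ordinal lt_mn)) => [j|]; rewrite /z /=.
  by rewrite -val_eqE /= ltnS (leq_eqVlt j) => /negbTE ->.
by rewrite ltnn ltnSn; apply: le_xy.
Qed.

Theorem theorem13 (R : realType) (n r d : nat) (r_gt0 : (1 <= r)%N)
    (r_le_d : (r <= d)%N) (X : Type)
    (Phi : ('I_n -> X) -> X) (Gamma : ('I_n -> R) -> R)
    (Gamma_nondecreasing : nondecreasing_in_each_variable Gamma)
    (Lambda : rsubset r d -> X -> R)
    (Theta : Gr R r d -> X -> R)
    (Fminus Fplus : X -> complete_flag R d)
    (L1 : forall (x : X) (I : rsubset r d) (L : Gr R r d),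
       (Omega (dual I) (Fminus x) L -> Lambda I x <= Theta L x) /\
       (Omega I (Fplus x) L -> Theta L x <= Lambda I x))
    (L2 : forall (L : Gr R r d) (x : 'I_n -> X),
       Theta L (Phi x) >= Gamma (fun k => Theta L (x k)))
    (I : 'I_n -> rsubset r d) (K : rsubset r d)
    (horn_IK : horn_tuple R I K) (x : 'I_n -> X) :
  Lambda K (Phi x) >= Gamma (fun k => Lambda (I k) (x k)).
Proof.
have [L [L_I L_K]] := horn_IK (fun k => Fminus (x k)) (Fplus (Phi x)).
(* The chain runs through [Theta L (Phi x)], then [Gamma] of the values [Theta L (x k)]; only a
   coordinatewise comparison remains. *)
apply: le_trans ((L1 _ _ _).2 L_K); apply: le_trans (L2 L x).
apply: nondecreasing_in_each_variable_le => // k.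
by apply: (L1 _ _ _).1; apply: L_I.
Qed.
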